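(* Let $p$ be an odd prime, $L=\mathbb F_{p^m}$, $\sigma=p^s$ with $0<s<m$, and let $K_1=\mathbb F_{p^{\gcd(m,s)}}\subseteq K_2=\mathbb F_{p^{\gcd(m,2s)}}$ be the fixed fields of $x\mapsto x^{\sigma}$ and $x\mapsto x^{\sigma^2}$ in $L$. Let $\mathbb N_m$ denote the middle nucleus of the semifield associated with the presemifield under consideration, and identify $L$ with $L\times\{0\}$. (i) For $C(p,m,s,l,R)$: $\mathbb N_m$ is $K_2$ if $R\notin K_1^*(L^* )^{\sigma+1}$, and is a quadratic extension of $K_2$ otherwise. (ii) For $B(p,m,s,l,n,n^{\sigma-1})$: $\mathbb N_m$ is $K_2$ if $1-1/n\notin K_1^*(L^* )^{\sigma+1}$, and is a quadratic extension of $K_2$ otherwise. (iii) For $B(p,m,s,l,n,N)$ with $N\neq n^{\sigma-1}$: $\mathbb N_m\cap L=K_1$. (iv) For $B(p,2k,k,l,n,N)$ with $q=p^k$ (so $m=2k$, $s=k$, $\sigma=q$) and $N\ne n^{\sigma-1}=n^{q-1}$: $\mathbb N_m$ is a quadratic extension of $K_1=\mathbb F_q$.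
   Context: A finite presemifield $(F,+,* )$ is a finite abelian group $(F,+)$ with a multiplication satisfying both distributive laws and such that $x*y=0$ implies $x=0$ or $y=0$; a semifield is a presemifield with identity. For an integer $k\ge0$, $L^k=\{x^k:x\in L\}$ and $(L^* )^k=\{x^k:x\in L^*\}$. $B(p,m,s,l,n,N)$ is defined for $l,n,N\in L^*$ with $-l\notin L^{\sigma-1}$ and $x^{\sigma+1}+(1-1/N)x+(1/n-1)/N\ne0$ for all $x\in L$: it is $F=L^2$ with multiplication $(a,b)*(c,d)=(h(a,b,c,d),\,ad+bc)$, where $$h(a,b,c,d)=ac^{\sigma}-nNbd^{\sigma}+l(a^{\sigma}c-nNb^{\sigma}d)+n\{Nad^{\sigma}-bc^{\sigma}+l(a^{\sigma}d-Nb^{\sigma}c)\}.$$ $C(p,m,s,l,R)$ is defined for $l,R\in L^*$ with $-l\notin L^{\sigma-1}$ and $R\notin L^{\sigma+1}$: it is $F=L^2$ with multiplication $(a,b)*(c,d)=\big(ac^{\sigma}+Rbd^{\sigma}+l(a^{\sigma}c+Rb^{\sigma}d),\ ad+bc\big)$. Associated semifield: put $e=(1,0)$, define $\beta,\gamma\colon F\to F$ by $e*\beta(x)=x$ and $\gamma(x)*e=e*x$, and set $x\circ y=\beta(\gamma(x)*y)$. Then $(F,+,\circ)$ is a semifield isotopic to $(F,+,* )$ with identity $e$. The set $L\times\{0\}\subset F$ is identified with $L$. The middle nucleus of a semifield $(F,+,\circ)$ is $\mathbb N_m=\{u:(x\circ u)\circ y=x\circ(u\circ y)\ \forall x,y\in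 F\}$, which is a finite field under $+$ and $\circ$. *)

(* Defs.v *)
From mathcomp Require Import all_boot all_order all_algebra.

Set Implicit Arguments.
Unset Strict Implicit.
Unset Printing Implicit Defensive.

Import GRing.Theory.
Local Open Scope ring_scope.

(* L^k and (L^* )^k *)
Definition kpowers (L : finFieldType) (k : nat) : {set L} :=
  [set x ^+ k | x : L].

Definition nz_kpowers (L : finFieldType) (k : nat) : {set L} :=
  [set x ^+ k | x in [set~ (0 : L)]].

(* For q a power of the characteristic, this is a subfield of L. *)
Definition fixed_field (L : finFieldType) (q : nat) : {set L} :=
  [set x : L | x ^+ q == x].

(* K^* (L^* )^k *)
Definition nz_mul_kpowers (L : finFieldType) (K : {set L}) (k : nat) : {set L} :=
  [set a * b | a in K :\ 0, b in nz_kpowers L k].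

(* In the following four definitions sg is the integer p ^ s, so that
   x^sigma is x ^+ sg; the dependence on p and m is through L. *)
Definition B_params (L : finFieldType) (sg : nat) (l n N : L) : Prop :=
  [/\ [&& l != 0, n != 0 & N != 0],
      - l \notin kpowers L sg.-1
    & forall x : L,
        x ^+ sg.+1 + (1 - 1 / N) * x + (1 / n - 1) / N != 0].

Definition B_mul (L : finFieldType) (sg : nat) (l n N : L)
    (u v : L * L) : L * L :=
  let: (a, b) := u in
  let: (c, d) := v in
  (a * c ^+ sg - n * N * b * d ^+ sg
     + l * (a ^+ sg * c - n * N * b ^+ sg * d)
     + n * (N * a * d ^+ sg - b * c ^+ sg
              + l * (a ^+ sg * d - N * b ^+ sg * c)),
   a * d + b * c).

Definition C_params (L : finFieldType) (sg : nat) (l R : L) : Prop :=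
  [/\ (l != 0) && (R != 0),
      - l \notin kpowers L sg.-1
    & R \notin kpowers L sg.+1].

Definition C_mul (L : finFieldType) (sg : nat) (l R : L)
    (u v : L * L) : L * L :=
  let: (a, b) := u in
  let: (c, d) := v in
  (a * c ^+ sg + R * b * d ^+ sg + l * (a ^+ sg * c + R * b ^+ sg * d),
   a * d + b * c).

(* The maps beta and gamma with e * beta x = x and gamma x * e = e * x.
   The default value x is only taken when no solution exists, which does not
   happen when left and right multiplication by e are injective (as in a
   presemifield, e being nonzero): see assoc_betaP and assoc_gammaP. *)
Definition assoc_beta (F : finType) (mul : F -> F -> F) (e x : F) : F :=
  odflt x [pick y | mul e y == x].

Definition assoc_gamma (F : finType) (mul : F -> F -> F) (e x : F) : F :=
  odflt x [pick y | mul y e == mul e x].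

Definition assoc_mul (F : finType) (mul : F -> F -> F) (e x y : F) : F :=
  assoc_beta mul e (mul (assoc_gamma mul e x) y).

Lemma assoc_betaP (F : finType) (mul : F -> F -> F) (e : F) :
  injective (mul e) -> forall x, mul e (assoc_beta mul e x) = x.
Proof.
move=> inj x; rewrite /assoc_beta; case: pickP => [y /eqP //|none].
by have := none (invF inj x); rewrite f_invF eqxx.
Qed.

Lemma assoc_gammaP (F : finType) (mul : F -> F -> F) (e : F) :
  injective (mul^~ e) ->
  forall x, mul (assoc_gamma mul e x) e = mul e x.
Proof.
move=> inj x; rewrite /assoc_gamma; case: pickP => [y /eqP //|none].
by have := none (invF inj (mul e x)); rewrite (f_invF inj) eqxx.
Qed.

Definition middle_nucleus (F : finType) (mul : F -> F -> F) : {set F} :=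
  [set u | [forall x, forall y, mul (mul x u) y == mul x (mul u y)]].

(* M is a field under the addition of V and the multiplication mul. *)
Record field_on (V : zmodType) (mul : V -> V -> V) (one : V)
    (M : {pred V}) : Prop := FieldOn {
  field_on_zmod : zmod_closed M;
  field_on_mul : {in M &, forall x y, mul x y \in M};
  field_on_mulA : {in M & &, associative mul};
  field_on_mulC : {in M &, commutative mul};
  field_on_mulDl : {in M & &, left_distributive mul +%R};
  field_on_1 : one \in M;
  field_on_1_neq0 : one != 0;
  field_on_mul1 : {in M, left_id one mul};
  field_on_inv :
    {in M, forall x, x != 0 -> exists2 y, y \in M & mul y x = one}
}.

(* M / K is an extension of fields inside V with [M : K] = d: M has a basis
   w of length d as a K-vector space. *)
Definition extension_of_degree (V : zmodType) (mul : V -> V -> V) (one : V)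
    (d : nat) (K M : {pred V}) : Prop :=
  [/\ field_on mul one K, field_on mul one M, {subset K <= M} &
    exists w : 'I_d -> V,
      (forall i, w i \in M) /\
      {in M, forall z, exists! c : {ffun 'I_d -> V},
        (forall i, c i \in K) /\ z = \sum_(i < d) mul (c i) (w i)}].

(* The identification of L with L x {0}. *)
Definition emb (L : finFieldType) (x : L) : L * L := (x, 0).

(* The identification takes the product of L on K to mul. *)
Definition emb_multiplicative (L : finFieldType)
    (mul : L * L -> L * L -> L * L) (K : {set L}) : Prop :=
  {in K &, forall x y : L, mul (emb x) (emb y) = emb (x * y)}.

Definition equals_subfield (L : finFieldType)
    (mul : L * L -> L * L -> L * L) (M : {set L * L}) (K : {set L}) : Prop :=
  emb_multiplicative mul K /\ M = @emb L @: K.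

Definition quadratic_extension (L : finFieldType)
    (mul : L * L -> L * L -> L * L) (M : {set L * L}) (K : {set L}) : Prop :=
  emb_multiplicative mul K /\
  extension_of_degree mul (emb 1) 2 (mem (@emb L @: K)) (mem M).

(* The multiplication of the semifield associated with a presemifield on
   L x L, with identity e = (1, 0). *)
Definition semifield_mul (L : finFieldType)
    (mul : L * L -> L * L -> L * L) : L * L -> L * L -> L * L :=
  assoc_mul mul (1, 0).

(* Main.v *)
Require Import Defs.
From mathcomp Require Import all_boot all_order all_algebra all_field ring.
Import GRing.Theory.
Local Open Scope ring_scope.

(** Both families are instances of one construction.  Write sigma for the
automorphism x |-> x ^ (p ^ s), X = (a, b), Y = (c, d), let J negate the
second coordinate and put M = [[1, mu], [nu, rho]]; then
  X * Y = (X^T M Y^sigma + l (JY)^T M (JX)^sigma, ad + bc),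
with (mu, nu, rho) = (nN, -n, -nN) for B and (0, 0, R) for C.

An element u lies in the middle nucleus exactly when the map v |-> u o v has an
adjoint A, that is A(X) * Y = X * (u o Y) for all X, Y
([middle_nucleus_adjoint], [adjoint_middle_nucleus]).  The second coordinate
ad + bc is a nondegenerate L-bilinear form, so it forces u o _ to be given by an
L-linear matrix T, whose first column is u.  As sigma is not the identity, the
terms a c^sigma and a^sigma c of the first coordinate can be compared
separately, and they say that T Q = Q T^sigma, where Q = [[nu, rho], [1, mu]].
The condition obtained from the terms with l is equivalent, since it involves
the adjugate of Q in place of Q.  So the middle nucleus is the twisted
centralizer of a 2 x 2 matrix, and the top right entry of T and the bottom right
one are determined by u ([nucleus_commutantP], [nucleus_mulE]).

If mu = - sigma nu, which covers C and the case N = n ^ (sigma - 1) of B, a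
shear brings Q to [[0, D], [1, 0]] with D = rho - nu mu, and the equation
decouples ([sheared_nucleusP]): one coordinate ranges over K2, the other one, z,
satisfies sigma (D sigma z) = D z, that is D z^(sigma + 1) \in K1.  A nonzero
such z exists exactly when D is in K1^* (L^* )^(sigma + 1), and any two of
them differ by a factor in K2.  When K1 <> K2 there is none: every element of K1
is then a norm w sigma w ([fixed1_norm]), so that D would be a (sigma + 1)-st
power, which absence of zero divisors excludes.

If mu <> - sigma nu, comparing entries for u in L gives
(mu + sigma nu) sigma (u - sigma u) = 0, whence u is in K1.  If moreover
sigma^2 = 1, every T in the centralizer commutes with W = Q Q^sigma, which is in
the centralizer and is not scalar, as its bottom left entry is mu + sigma nu;
hence the middle nucleus is K1[W] ([unsheared_nucleus_quadratic]). *)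

(** * The middle nucleus of an associated semifield *)

Section AssociatedSemifield.

Variables (F : finType) (mul : F -> F -> F) (e : F).
Hypotheses (mul_e_inj : injective (mul e)) (mul_inj_e : injective (mul^~ e)).

Local Notation "x ** y" := (assoc_mul mul e x y) (at level 40).
Local Notation gamma := (assoc_gamma mul e).

Lemma mul_e_assoc_mul x y : mul e (x ** y) = mul (gamma x) y.
Proof. exact: assoc_betaP. Qed.

Lemma assoc_gamma_unique x y : mul y e = mul e x -> gamma x = y.
Proof. by move=> yE; apply: mul_inj_e; rewrite assoc_gammaP. Qed.

Lemma assoc_gamma_e : gamma e = e.
Proof. exact: assoc_gamma_unique. Qed.

Lemma assoc_gamma_inj : injective gamma.
Proof.
move=> x y gxy; apply: mul_e_inj.
by rewrite -(assoc_gammaP mul_inj_e x) -(assoc_gammaP mul_inj_e y) gxy.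
Qed.

Lemma assoc_mul_e x : x ** e = x.
Proof. by apply: mul_e_inj; rewrite mul_e_assoc_mul assoc_gammaP. Qed.

Lemma assoc_e_mul x : e ** x = x.
Proof. by apply: mul_e_inj; rewrite mul_e_assoc_mul assoc_gamma_e. Qed.

Lemma middle_nucleusP u :
  reflect (forall x y, (x ** u) ** y = x ** (u ** y))
          (u \in middle_nucleus (assoc_mul mul e)).
Proof.
rewrite inE; apply: (iffP forallP) => [uN x y|uN x].
  by have /forallP/(_ y)/eqP := uN x.
by apply/forallP => y; apply/eqP.
Qed.

(** The adjoint is right multiplication by [u], transported by the bijection
[assoc_gamma] from the semifield to the left factors of the presemifield. *)
Lemma middle_nucleus_adjoint {u} :
  u \in middle_nucleus (assoc_mul mul e) ->
  exists A, forall x y, mul (A x) y = mul x (u ** y).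
Proof.
move=> /middle_nucleusP uN.
exists (fun x => gamma (invF assoc_gamma_inj x ** u)).
move=> x y; rewrite -[in RHS](f_invF assoc_gamma_inj x).
by rewrite -!mul_e_assoc_mul uN.
Qed.

(** Evaluating the adjunction at [e] identifies [B] with left multiplication by
[B e], so neither additivity nor linearity of [A] and [B] has to be assumed. *)
Lemma adjoint_middle_nucleus (A B : F -> F) :
  (forall x y, mul (A x) y = mul x (B y)) ->
  B e \in middle_nucleus (assoc_mul mul e) /\ forall y, B e ** y = B y.
Proof.
move=> AB.
have gammaB x : gamma (x ** B e) = A (gamma x).
  by apply: assoc_gamma_unique; rewrite mul_e_assoc_mul AB.
have BE y : B e ** y = B y.
  apply: mul_e_inj; rewrite mul_e_assoc_mul.
  by rewrite -[in LHS](assoc_e_mul (B e)) gammaB assoc_gamma_e AB.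
split=> //; apply/middle_nucleusP => x y; apply: mul_e_inj.
by rewrite !mul_e_assoc_mul gammaB AB BE.
Qed.

Lemma middle_nucleus_mul u v :
  u \in middle_nucleus (assoc_mul mul e) ->
  v \in middle_nucleus (assoc_mul mul e) ->
  u ** v \in middle_nucleus (assoc_mul mul e).
Proof.
move=> /middle_nucleusP uN /middle_nucleusP vN.
by apply/middle_nucleusP => x y; rewrite -uN !vN uN.
Qed.

End AssociatedSemifield.

(** * Norms to the fixed field of sigma *)

Section Norms.

Variables (L : finFieldType) (sigma : {rmorphism L -> L}).

Definition fixed1 : {set L} := [set x | sigma x == x].
Definition fixed2 : {set L} := [set x | sigma (sigma x) == x].

Lemma fixed1P {x} : reflect (sigma x = x) (x \in fixed1).
Proof. by rewrite inE; apply: eqP. Qed.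

Lemma fixed2P {x} : reflect (sigma (sigma x) = x) (x \in fixed2).
Proof. by rewrite inE; apply: eqP. Qed.

Lemma fixed1_sub2 : fixed1 \subset fixed2.
Proof. by apply/subsetP => x /fixed1P sx; apply/fixed2P; rewrite !sx. Qed.

(** Squaring has fibres of size at most 2, and 0 has only one square root.  The
second component of [f] tells [x] from [- x] by their ranks; the value
[(0, true)] is never taken. *)
Lemma card_squares : (2%:R : L) != 0 ->
  (#|fixed1| < 2 * #|[set x ^+ 2 | x in fixed1]|)%N.
Proof.
move=> two0; set S := [set _ | x in _].
have S0 : 0 \in S.
  by apply/imsetP; exists 0; [apply/fixed1P; rewrite rmorph0|rewrite expr0n].
pose f (x : L) := (x ^+ 2, enum_rank x < enum_rank (- x))%N.
have f_inj : injective f.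
  move=> x y [/eqP]; rewrite eqf_sqr => /orP[/eqP //|/eqP->] ranks.
  have /eqP rank_eq : enum_rank y == enum_rank (- y).
    by move: ranks; rewrite opprK -val_eqE /=; case: ltngtP.
  have /eqP := enum_rank_inj rank_eq; rewrite eq_sym -subr_eq0 -opprD oppr_eq0.
  by rewrite -mulr2n -mulr_natl mulf_eq0 (negPf two0) => /eqP->; rewrite oppr0.
have -> : (2 * #|S| = #|setX S [set: bool]|)%N.
  by rewrite cardsX cardsT card_bool mulnC.
rewrite -(card_imset _ f_inj); apply/proper_card/properP; split.
  apply/subsetP => _ /imsetP[x xK ->]; rewrite in_setX in_setT andbT.
  exact: imset_f.
exists (0, true); first by rewrite in_setX S0 in_setT.
apply/imsetP => -[x _ [/esym/eqP]]; rewrite sqrf_eq0 => /eqP->.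
by rewrite oppr0 ltnn.
Qed.

(** With [sigma j = - j], the norm of [x + j * y] for [x], [y] in
[fixed1 sigma] is [x ^+ 2 - j ^+ 2 * y ^+ 2].  It takes every value [k],
because the squares and the elements [k + j ^+ 2 * y ^+ 2] each fill more than
half of [fixed1 sigma] and therefore meet. *)
Lemma fixed1_norm {k} : (2%:R : L) != 0 -> fixed2 != fixed1 -> k \in fixed1 ->
  exists w, k = w * sigma w.
Proof.
move=> two0 neq12 kK.
have [i iK2 iK1] : exists2 i, i \in fixed2 & i \notin fixed1.
  apply/subsetPn; apply: contra neq12 => sub.
  by rewrite eqEsubset sub fixed1_sub2.
set j := i - sigma i.
have sj : sigma j = - j by rewrite /j rmorphB (fixed2P iK2) opprB.
have j0 : j != 0 by rewrite subr_eq0 eq_sym; apply: contra iK1 => /eqP/fixed1P.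
set S := [set x ^+ 2 | x in fixed1].
have T_card : #|[set k + j ^+ 2 * x | x in S]| = #|S|.
  by apply: card_imset => x y /addrI/mulfI; apply; rewrite sqrf_eq0.
set T := [set k + _ | x in S] in T_card.
have SK : S \subset fixed1.
  apply/subsetP => _ /imsetP[x /fixed1P xK ->].
  by apply/fixed1P; rewrite rmorphXn xK.
have TK : T \subset fixed1.
  apply/subsetP => _ /imsetP[x /(subsetP SK)/fixed1P xK ->]; apply/fixed1P.
  by rewrite rmorphD rmorphM rmorphXn sj xK sqrrN (fixed1P kK).
have : S :&: T != set0.
  apply/negP => /eqP ST0; have := cardsUI S T.
  rewrite ST0 cards0 addn0 T_card addnn -mul2n => cardU.
  have : S :|: T \subset fixed1 by rewrite subUset SK.
  by move/subset_leq_card; rewrite cardU leqNgt card_squares.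
case/set0Pn => _ /setIP[/imsetP[x /fixed1P xK ->]].
case/imsetP=> _ /imsetP[y /fixed1P yK ->] xy.
exists (x + j * y); rewrite rmorphD rmorphM sj xK yK.
transitivity (x ^+ 2 - j ^+ 2 * y ^+ 2); last by ring.
by rewrite xy addrK.
Qed.

End Norms.

Arguments fixed1 {L}.
Arguments fixed2 {L}.
Arguments fixed1P {L sigma x}.
Arguments fixed2P {L sigma x}.

(** * A family containing B and C *)

Section TwistedFamily.

Variables (L : finFieldType) (sigma : {rmorphism L -> L}) (l mu nu rho : L).

(** The form X^T M Y^sigma with M = [[1, mu], [nu, rho]]. *)
Definition sform (X Y : L * L) : L :=
  X.1 * (sigma Y.1 + mu * sigma Y.2) + X.2 * (nu * sigma Y.1 + rho * sigma Y.2).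

Definition flip (X : L * L) : L * L := (X.1, - X.2).

Variable mul : L * L -> L * L -> L * L.
Hypothesis mulE : forall X Y,
  mul X Y = (sform X Y + l * sform (flip Y) (flip X), X.1 * Y.2 + X.2 * Y.1).
Hypothesis l_free : forall t, t + l * sigma t = 0 -> t = 0.
Hypothesis sform_aniso : forall Y, sform (flip Y) Y = 0 -> Y = 0.
Hypothesis sigma_neq_id : exists a, sigma a != a.

(** If the second coordinate vanishes, then X = t JY for some t in L, and the
first coordinate becomes (t + l t^sigma) (JY)^T M Y^sigma. *)
Lemma mul_eq0_or X Y : mul X Y = 0 -> X = 0 \/ Y = 0.
Proof.
rewrite mulE => -[h0 g0]; have [->|Y0] := eqVneq Y 0; [by right|left].
have [t XE] : exists t, X = (t * Y.1, - (t * Y.2)).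
  case: X Y Y0 g0 {h0} => [a b] [c d] /= Y0 g0.
  have [c0|c0] := eqVneq c 0.
    have d0 : d != 0 by apply: contra Y0 => /eqP->; rewrite c0.
    exists (- b / d); rewrite c0; congr pair; last by field.
    apply/eqP; move/eqP: g0.
    by rewrite c0 mulr0 addr0 mulf_eq0 (negPf d0) orbF mulr0.
  exists (a / c); congr pair; first by field.
  by apply: (mulIf c0); rewrite -[RHS]add0r -g0; field.
have : (t + l * sigma t) * sform (flip Y) Y = 0.
  by rewrite -[RHS]h0 XE /sform /flip /=; ring.
move/eqP; rewrite mulf_eq0 => /orP[/eqP/l_free t0|/eqP/sform_aniso/eqP].
  by rewrite XE t0 !mul0r oppr0.
by rewrite (negPf Y0).
Qed.

Lemma mulBl X Y Z : mul (X - Y) Z = mul X Z - mul Y Z.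
Proof.
case: X Y Z => [a b] [a' b'] [c d]; rewrite !mulE /sform /flip /=.
by congr pair => /=; ring.
Qed.

Lemma mulBr X Y Z : mul X (Y - Z) = mul X Y - mul X Z.
Proof.
case: X Y Z => [a b] [a' b'] [c d]; rewrite !mulE /sform /flip /=.
by congr pair => /=; ring.
Qed.

Lemma mul_injl {X} : X != 0 -> injective (mul X).
Proof.
move=> X0 Y Z /eqP; rewrite -subr_eq0 -mulBr => /eqP/mul_eq0_or[/eqP|/eqP].
  by rewrite (negPf X0).
by rewrite subr_eq0 => /eqP.
Qed.

Lemma mul_injr {Y} : Y != 0 -> injective (mul^~ Y).
Proof.
move=> Y0 X Z /eqP; rewrite -subr_eq0 -mulBl => /eqP/mul_eq0_or[/eqP|/eqP].
  by rewrite subr_eq0 => /eqP.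
by rewrite (negPf Y0).
Qed.

Lemma e_neq0 : (1, 0) != 0 :> L * L.
Proof. by apply/eqP => -[/eqP]; rewrite oner_eq0. Qed.

Definition form_det : L := rho - nu * mu.

(** A singular M would kill Y^sigma for some Y != 0, as sigma is onto. *)
Lemma form_det_neq0 : form_det != 0.
Proof.
have sigma_inj : injective sigma by exact: fmorph_inj.
apply/eqP => D0; pose Y := (- invF sigma_inj mu, 1 : L).
have /sform_aniso[_ /eqP] : sform (flip Y) Y = 0; last by rewrite oner_eq0.
rewrite /sform /flip /= rmorphN rmorph1 f_invF.
transitivity (- form_det); last by rewrite D0 oppr0.
by rewrite /form_det; ring.
Qed.

Lemma sigma_separates P Q :
  (forall a c, P * (a * sigma c) + Q * (sigma a * c) = 0) -> P = 0.
Proof.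
move=> PQ; have [a sa] := sigma_neq_id.
have /eqP := PQ 1 1; rewrite rmorph1 !mulr1 addr_eq0 => /eqP PE.
have /eqP := PQ a 1; rewrite rmorph1 !mulr1 PE.
rewrite mulNr addrC -mulrBr mulf_eq0 subr_eq0 (negPf sa) orbF => /eqP->.
exact: oppr0.
Qed.

(** If T = [[u.1, y], [u.2, w]] satisfies T Q = Q T^sigma, where
Q = [[nu, rho], [1, mu]], then the first column of that equation gives
y = [entry12 u] and w = [entry22 u]. *)
Definition entry12 (u : L * L) : L := nu * (sigma u.1 - u.1) + rho * sigma u.2.
Definition entry22 (u : L * L) : L := sigma u.1 + mu * sigma u.2 - nu * u.2.

Definition act (u v : L * L) : L * L :=
  (u.1 * v.1 + entry12 u * v.2, u.2 * v.1 + entry22 u * v.2).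

(** The second column of T Q - Q T^sigma, for the matrix T of [act u]. *)
Definition defect1 (u : L * L) : L :=
  rho * u.1 + mu * entry12 u
  - (nu * sigma (entry12 u) + rho * sigma (entry22 u)).
Definition defect2 (u : L * L) : L :=
  rho * u.2 + mu * entry22 u
  - (sigma (entry12 u) + mu * sigma (entry22 u)).

Definition twisted_commutant (u : L * L) : Prop :=
  defect1 u = 0 /\ defect2 u = 0.

Local Notation smul := (semifield_mul mul).
Local Notation Nm := (middle_nucleus smul).

(** The adjoint of T with respect to ad + bc is A = [[w, y], [u.2, u.1]], where
(y, w) is the second column of T.  That A and T are also adjoint for [sform] is
the equation T Q = Q T^sigma; for its companion with [flip], multiply this
equation on both sides by the adjugate of Q, which costs the factor
[form_det]. *)
Lemma commutant_nucleus u :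
  twisted_commutant u -> u \in Nm /\ forall v, smul u v = act u v.
Proof.
move=> [defect1_0 defect2_0].
pose A X : L * L := (entry22 u * X.1 + entry12 u * X.2, u.2 * X.1 + u.1 * X.2).
have actE : act u (1, 0) = u.
  by rewrite /act /= !mulr1 !mulr0 !addr0 -surjective_pairing.
suff AB X Y : mul (A X) Y = mul X (act u Y).
  have := adjoint_middle_nucleus _ _ _ (mul_injl e_neq0) (mul_injr e_neq0)
    A (act u) AB.
  by rewrite actE.
have fst_form : sform (A X) Y = sform X (act u Y).
  apply/eqP; rewrite -subr_eq0; apply/eqP.
  transitivity (X.1 * sigma Y.2 * defect2 u + X.2 * sigma Y.2 * defect1 u).
    rewrite /sform /A /act /defect1 /defect2 /entry12 /entry22 /=.
    by ring.
  by rewrite defect1_0 defect2_0 !mulr0 addr0.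
have snd_form :
    sform (flip Y) (flip (A X)) = sform (flip (act u Y)) (flip X).
  apply: (mulfI form_det_neq0); apply/eqP; rewrite -subr_eq0; apply/eqP.
  transitivity (- (defect1 u - nu * defect2 u)
      * (Y.1 * sigma X.1 - mu * (Y.1 * sigma X.2)
         - nu * (Y.2 * sigma X.1) + rho * (Y.2 * sigma X.2))
    + form_det * (defect1 u * (Y.2 * sigma X.2)
                  - defect2 u * (Y.1 * sigma X.2))).
    rewrite /sform /flip /A /act /form_det /defect1 /defect2.
    by rewrite /entry12 /entry22 /=; ring.
  by rewrite defect1_0 defect2_0; ring.
by rewrite !mulE fst_form snd_form /A /act /=; congr pair; ring.
Qed.

Lemma nucleus_commutant u : u \in Nm -> twisted_commutant u.
Proof.
move=> uN.
have [A AB] : exists A, forall X Y, mul (A X) Y = mul X (smul u Y) :=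
  middle_nucleus_adjoint _ _ _ (mul_injl e_neq0) (mul_injr e_neq0) uN.
have u1 : smul u (1, 0) = u.
  exact: assoc_mul_e _ _ _ (mul_injl e_neq0) (mul_injr e_neq0) u.
have [y [w col2]] : exists y w, smul u (0, 1) = (y, w).
  by case: (smul u _) => y w; exists y, w.
have snd_eq X Y : (A X).1 * Y.2 + (A X).2 * Y.1 =
    X.1 * (smul u Y).2 + X.2 * (smul u Y).1.
  by have := AB X Y; rewrite !mulE => -[].
(* Testing the second coordinate on the standard basis makes [A] and [smul u]
   linear. *)
have AE X : A X = (w * X.1 + y * X.2, u.2 * X.1 + u.1 * X.2).
  rewrite [LHS]surjective_pairing; congr pair.
    by have := snd_eq X (0, 1); rewrite col2 /= mulr1 mulr0 addr0 => ->; ring.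
  by have := snd_eq X (1, 0); rewrite u1 /= mulr1 mulr0 add0r => ->; ring.
have BE Y : smul u Y = (u.1 * Y.1 + y * Y.2, u.2 * Y.1 + w * Y.2).
  rewrite [LHS]surjective_pairing; congr pair.
    have := snd_eq (0, 1) Y.
    by rewrite AE /= !mulr0 !mulr1 mul1r mul0r !add0r => <-; ring.
  have := snd_eq (1, 0) Y.
  by rewrite AE /= !mulr0 !mulr1 mul1r mul0r !addr0 => <-; ring.
have fst_eq X Y := congr1 fst (AB X Y).
(* Each of the four pairs of basis vectors contributes one entry of
   T Q = Q T^sigma, as the coefficient of a * sigma c; the witness is the
   coefficient of sigma a * c. *)
have w_eq : w = entry22 u.
  apply/eqP; rewrite -subr_eq0; apply/eqP.
  apply: (sigma_separates _ (l * (sigma w - mu * sigma u.2 - u.1 + nu * u.2))).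
  move=> a c; have /eqP := fst_eq (a, 0) (c, 0).
  rewrite !mulE AE BE /sform /flip /= -subr_eq0 => /eqP <-.
  by rewrite /entry22; ring.
have y_eq : y = entry12 u.
  apply/eqP; rewrite -subr_eq0; apply/eqP.
  apply: (sigma_separates _
    (l * (sigma y - mu * sigma u.1 + mu * u.1 - rho * u.2))).
  move=> a c; have /eqP := fst_eq (0, a) (c, 0).
  rewrite !mulE AE BE /sform /flip /= -subr_eq0 => /eqP <-.
  by rewrite /entry12; ring.
split.
  apply: (sigma_separates _
    (l * (rho * sigma u.1 - nu * sigma y + mu * y - rho * w))).
  move=> a c; have /eqP := fst_eq (0, a) (0, c).
  rewrite !mulE AE BE /sform /flip /= -subr_eq0 => /eqP <-.
  by rewrite /defect1 -w_eq -y_eq; ring.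
apply: (sigma_separates _
  (l * (rho * sigma u.2 - nu * sigma w - y + nu * w))).
move=> a c; have /eqP := fst_eq (a, 0) (0, c).
rewrite !mulE AE BE /sform /flip /= -subr_eq0 => /eqP <-.
by rewrite /defect2 -w_eq -y_eq; ring.
Qed.

Lemma nucleus_commutantP u : reflect (twisted_commutant u) (u \in Nm).
Proof.
by apply: (iffP idP) => [/nucleus_commutant|/commutant_nucleus[]].
Qed.

Lemma nucleus_mulE u v : u \in Nm -> smul u v = act u v.
Proof. by move=> /nucleus_commutant/commutant_nucleus[]. Qed.

Local Notation K1 := (fixed1 sigma).
Local Notation K2 := (fixed2 sigma).

Lemma emb_fixed1_nucleus k : k \in K1 -> emb k \in Nm.
Proof.
move=> /fixed1P kK; apply/nucleus_commutantP.
have y0 : entry12 (emb k) = 0.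
  by rewrite /entry12 /= kK rmorph0; ring.
have wk : entry22 (emb k) = k.
  by rewrite /entry22 /= kK rmorph0; ring.
by split; rewrite /defect1 /defect2 y0 wk /= rmorph0 kK; ring.
Qed.

Lemma emb_nucleus_mul k v :
  emb k \in Nm -> smul (emb k) (emb v) = emb (k * v).
Proof.
by move=> kN; rewrite nucleus_mulE // /act /emb /= !mulr0 mul0r !addr0.
Qed.

Lemma emb_fixed1_mul k v : k \in K1 -> smul (emb k) v = (k * v.1, k * v.2).
Proof.
move=> kK; rewrite nucleus_mulE ?emb_fixed1_nucleus //.
by rewrite /act /entry12 /entry22 /= rmorph0 (fixed1P kK); congr pair; ring.
Qed.

Lemma smul_eq0 u v : smul u v = 0 -> u = 0 \/ v = 0.
Proof.
have mul_0 X : mul X 0 = 0.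
  by have := mulBr X 0 0; rewrite !subr0 subrr.
move=> uv0; have := mul_e_assoc_mul _ _ _ (mul_injl e_neq0) u v.
rewrite [assoc_mul _ _ _ _]uv0 mul_0 => /esym/mul_eq0_or[gu|]; [left|by right].
apply: (mul_injl e_neq0); rewrite mul_0.
rewrite -(assoc_gammaP (mul_injr e_neq0)) gu.
by have := mulBl 0 0 (1, 0); rewrite !subr0 subrr.
Qed.

Lemma nucleus_sub u v : u \in Nm -> v \in Nm -> u - v \in Nm.
Proof.
have defectB : defect1 (u - v) = defect1 u - defect1 v /\
               defect2 (u - v) = defect2 u - defect2 v.
  case: u v => [a b] [c d].
  by split; rewrite /defect1 /defect2 /entry12 /entry22 /=; ring.
move=> /nucleus_commutantP[u1 u2] /nucleus_commutantP[v1 v2].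
case: defectB => defect1B defect2B; apply/nucleus_commutantP.
by split; rewrite ?defect1B ?defect2B ?u1 ?v1 ?u2 ?v2 subrr.
Qed.

(** Inverses come from finiteness: left multiplication by a nonzero element of
[M] is an injection of [M] into itself. *)
Lemma nucleus_subfield (M : {set L * L}) :
  M \subset Nm -> (1, 0) \in M ->
  {in M &, forall u v, u - v \in M} -> {in M &, forall u v, smul u v \in M} ->
  {in M &, commutative smul} ->
  field_on smul (emb 1) (mem M).
Proof.
move=> /subsetP MN M1 Msub Mmul Mcomm.
have smulDr u v w : u \in M -> smul u (v + w) = smul u v + smul u w.
  case: v w => [a b] [c d] /MN uN; rewrite !nucleus_mulE // /act /=.
  by congr pair => /=; ring.
have Madd : {in M &, forall u v, u + v \in M}.
  move=> u v uM vM; have -> : u + v = u - (u - u - v).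
    by rewrite subrr sub0r opprK.
  by rewrite !Msub.
split=> //.
- by split=> //; rewrite -(subrr (1, 0)) Msub.
- move=> u v w uM vM wM; apply: esym.
  by have /middle_nucleusP := MN _ vM; apply.
- by move=> u v w uM vM wM; rewrite Mcomm ?Madd // smulDr // !(Mcomm w).
- exact: e_neq0.
- by move=> u _; apply: assoc_e_mul (mul_injl e_neq0) (mul_injr e_neq0) u.
move=> u uM u0.
have smul_u_inj : {in M &, injective (smul u)}.
  move=> v w vM wM /eqP; rewrite -subr_eq0 => vw; apply/eqP; rewrite -subr_eq0.
  have : smul u (v - w) = 0.
    by rewrite -(eqP vw) -[v in RHS](subrK w) [in RHS]smulDr // addrK.
  by case/smul_eq0 => [/eqP|->//]; rewrite (negPf u0).
have : smul u @: M = M.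
  apply/eqP; rewrite eqEcard card_in_imset // leqnn andbT.
  by apply/subsetP => _ /imsetP[v vM ->]; apply: Mmul.
move/setP/(_ (1, 0)); rewrite M1 => /imsetP[v vM uv]; exists v => //.
by rewrite Mcomm.
Qed.

(** Since the elements of K1 act as scalars, spanning by 1 and [w] over K1 makes
the middle nucleus commutative as well as two-dimensional. *)
Lemma quadratic_nucleus w :
  w \in Nm -> w.2 != 0 ->
  (forall u, u \in Nm -> exists s t,
     [/\ s \in K1, t \in K1 & u = (s + t * w.1, t * w.2)]) ->
  quadratic_extension smul Nm K1.
Proof.
move=> wN w0 span.
have combE s t : s \in K1 -> t \in K1 ->
    (s + t * w.1, t * w.2) = smul (emb s) (emb 1) + smul (emb t) w.
  move=> sK tK; rewrite !emb_fixed1_mul //=.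
  by congr pair; rewrite /= ?mulr1 ?mulr0 ?add0r.
have K1N : @emb L @: K1 \subset Nm.
  by apply/subsetP => _ /imsetP[k kK ->]; apply: emb_fixed1_nucleus.
have K1_1 : 1 \in K1 by apply/fixed1P; rewrite rmorph1.
have Nm_comm : {in Nm &, commutative smul}.
  move=> u v uN vN.
  have [s [t [/fixed1P sK /fixed1P tK uE]]] := span _ uN.
  have [s' [t' [/fixed1P sK' /fixed1P tK' vE]]] := span _ vN.
  rewrite !nucleus_mulE // uE vE /act /entry12 /entry22 /=.
  by rewrite !rmorphD !rmorphM sK tK sK' tK'; congr pair; ring.
have K1_comm : {in @emb L @: K1 &, commutative smul}.
  by apply: sub_in2 Nm_comm; apply/subsetP.
split.
  by move=> k k' kK _; rewrite emb_nucleus_mul // emb_fixed1_nucleus.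
split.
- apply: nucleus_subfield => //; first exact: imset_f.
    move=> _ _ /imsetP[k /fixed1P kK ->] /imsetP[k' /fixed1P kK' ->].
    apply/imsetP; exists (k - k'); last by congr pair; rewrite /= subr0.
    by apply/fixed1P; rewrite rmorphB kK kK'.
  move=> _ _ /imsetP[k kK ->] /imsetP[k' kK' ->].
  rewrite emb_nucleus_mul ?emb_fixed1_nucleus //; apply: imset_f.
  by apply/fixed1P; rewrite rmorphM; congr (_ * _); apply/fixed1P.
- apply: nucleus_subfield => //.
  + exact: emb_fixed1_nucleus K1_1.
  + by move=> u v; apply: nucleus_sub.
  + by move=> u v; apply: middle_nucleus_mul.
- exact/subsetP.
exists (fun i : 'I_2 => if i == ord0 then emb 1 else w); split.
  by move=> i; case: ifP; rewrite ?emb_fixed1_nucleus.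
move=> u uN; have [s [t [sK tK uE]]] := span _ uN.
exists [ffun i : 'I_2 => if i == ord0 then emb s else emb t]; split.
  split; first by move=> i; rewrite ffunE; case: ifP; rewrite imset_f.
  by rewrite uE combE // !big_ord_recl big_ord0 !ffunE /= addr0.
move=> c [cK]; rewrite !big_ord_recl big_ord0 /= addr0.
have /imsetP[s' sK' cs] := cK ord0.
have /imsetP[t' tK' ct] := cK (lift ord0 ord0).
rewrite cs ct -combE // uE => -[sE /(mulIf w0) tE].
apply/ffunP => i; rewrite ffunE.
case: (unliftP ord0 i) => [j ->|->]; last first.
  by rewrite eqxx cs; move: sE; rewrite tE => /addIr->.
by rewrite (ord1 j) /= ct tE.
Qed.

(** Conjugating T by the shear [[1, - nu], [0, 1]], and Q by it in the
sigma-twisted sense, turns Q into [[0, form_det], [1, 0]] and replaces [u.1] by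
[u.1 - nu * u.2]. *)
Lemma sheared_nucleusP u : mu = - sigma nu ->
  let x := u.1 - nu * u.2 in
  reflect
    (sigma (sigma x) = x /\ sigma (form_det * sigma u.2) = form_det * u.2)
    (u \in Nm).
Proof.
move=> muE x.
have defect2E : defect2 u = form_det * u.2 - sigma (form_det * sigma u.2).
  by rewrite /form_det /defect2 /entry12 /entry22 muE; ring.
have defect1E : defect1 u = form_det * (x - sigma (sigma x)) + nu * defect2 u.
  by rewrite defect2E /form_det /x /defect1 /entry12 /entry22 muE; ring.
apply: (iffP (nucleus_commutantP u)) => [[defect1_0 defect2_0]|[xx zz]].
  split; last by apply/esym/eqP; rewrite -subr_eq0 -defect2E defect2_0.
  move/eqP: defect1E; rewrite defect1_0 defect2_0 mulr0 addr0 eq_sym.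
  by rewrite mulf_eq0 (negPf form_det_neq0) subr_eq0 => /eqP.
have defect2_0 : defect2 u = 0 by rewrite defect2E zz subrr.
by split=> //; rewrite defect1E defect2_0 xx subrr !mulr0 addr0.
Qed.

Lemma sheared_nucleus_K2 : mu = - sigma nu ->
  (forall z, sigma (form_det * sigma z) = form_det * z -> z = 0) ->
  equals_subfield smul Nm K2.
Proof.
move=> muE zz_0.
have NmE : Nm = @emb L @: K2.
  apply/setP => u; apply/(sheared_nucleusP _ muE)/imsetP => [[xx /zz_0 u2]|].
    exists u.1; last by rewrite /emb -u2 -surjective_pairing.
    by apply/fixed2P; rewrite -[u.1]subr0 -(mulr0 nu) -u2.
  case=> k /fixed2P kK ->; rewrite /emb /= !mulr0 subr0 rmorph0 mulr0 rmorph0.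
  by rewrite kK.
split=> // k k' kK _; apply: emb_nucleus_mul.
by rewrite NmE imset_f.
Qed.

(** After the shear, the anisotropic form (JY)^T M Y^sigma is
x x^sigma - form_det z z^sigma; so [form_det] is not a norm. *)
Lemma norm_multiple_eq0 x z :
  mu = - sigma nu -> x * sigma x = form_det * (z * sigma z) ->
  x = 0 /\ z = 0.
Proof.
move=> muE xz.
have /sform_aniso[]: sform (flip (x + nu * z, z)) (x + nu * z, z) = 0.
  transitivity (x * sigma x - form_det * (z * sigma z)).
    by rewrite /sform /flip /form_det muE /=; ring.
  by rewrite xz subrr.
by move=> xz0 z0; split=> //; rewrite -xz0 z0 mulr0 addr0.
Qed.

(** A nonzero [z0] forces K1 = K2, by [fixed1_norm] and [norm_multiple_eq0]; the
quotient of two solutions of sigma (form_det sigma z) = form_det z is fixed by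
sigma^2, so the solutions form the line through [z0]. *)
Lemma sheared_nucleus_quadratic z0 : mu = - sigma nu -> (2%:R : L) != 0 ->
  z0 != 0 -> sigma (form_det * sigma z0) = form_det * z0 ->
  quadratic_extension smul Nm K2.
Proof.
move=> muE two0 z0_neq0 zz0.
have K12 : K2 = K1.
  apply/eqP; apply: contraNT z0_neq0 => neq12.
  have /(fixed1_norm _ _ two0 neq12)[w wE] : form_det * (z0 * sigma z0) \in K1.
    apply/fixed1P; rewrite mulrC -mulrA rmorphM [_ * form_det]mulrC zz0.
    by ring.
  by have [_ ->] := norm_multiple_eq0 _ _ muE (esym wE).
rewrite K12; apply: (quadratic_nucleus (nu * z0, z0)) => //=.
  by apply/(sheared_nucleusP _ muE); rewrite /= subrr !rmorph0.
move=> u /(sheared_nucleusP _ muE)[xx zz]; exists (u.1 - nu * u.2), (u.2 / z0).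
split.
- by rewrite -K12; apply/fixed2P.
- have D0 := form_det_neq0.
  have sD0 : sigma form_det != 0 by rewrite fmorph_eq0.
  have sigma2E z : sigma (form_det * sigma z) = form_det * z ->
      sigma (sigma z) = form_det * z / sigma form_det.
    by rewrite rmorphM => <-; field.
  rewrite -K12; apply/fixed2P.
  rewrite !fmorph_div (sigma2E _ zz) (sigma2E _ zz0).
  by field; rewrite D0 sD0 z0_neq0.
- by rewrite [LHS]surjective_pairing; congr pair; field.
Qed.

Lemma unsheared_nucleus_cap : mu != - sigma nu ->
  Nm :&: [set emb x | x : L] = [set emb x | x in K1].
Proof.
rewrite -subr_eq0 opprK => mu_nu.
apply/setP => u; apply/setIP/imsetP => [[uN /imsetP[x _ uE]]|[x xK ->]].
  exists x => //; move: uN; rewrite uE => /nucleus_commutantP[_ defect2_0].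
  have : (mu + sigma nu) * sigma (x - sigma x) = 0.
    by rewrite -defect2_0 /defect2 /entry12 /entry22 /= rmorph0; ring.
  move/eqP; rewrite mulf_eq0 (negPf mu_nu) fmorph_eq0 subr_eq0 => /eqP xE.
  exact/fixed1P.
by split; [apply: emb_fixed1_nucleus|apply: imset_f].
Qed.

(** Applying sigma to T Q = Q T^sigma shows that T commutes with W = Q Q^sigma.
As [W21] is nonzero, T = x + t W with t = u.2 / W21, and T Q = Q T^sigma then
says that x and t are fixed by sigma. *)
Lemma unsheared_nucleus_quadratic : mu != - sigma nu -> involutive sigma ->
  quadratic_extension smul Nm K1.
Proof.
rewrite -subr_eq0 opprK => mu_nu sigmaK.
pose W11 := nu * sigma nu + rho; pose W12 := nu * sigma rho + rho * sigma mu.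
pose W21 := sigma nu + mu; pose W22 := sigma rho + mu * sigma mu.
have W21_neq0 : W21 != 0 by rewrite /W21 addrC.
apply: (quadratic_nucleus (W11, W21)) => //=.
  apply/nucleus_commutantP; have y_eq : entry12 (W11, W21) = W12.
    by rewrite /entry12 /W11 /W12 /W21 /= !rmorphD !rmorphM !sigmaK; ring.
  have w_eq : entry22 (W11, W21) = W22.
    by rewrite /entry22 /W11 /W22 /W21 /= !rmorphD !rmorphM !sigmaK; ring.
  rewrite /twisted_commutant /defect1 /defect2 y_eq w_eq.
  rewrite /W11 /W12 /W21 /W22 /=.
  by rewrite !rmorphD !rmorphM !sigmaK; split; ring.
move=> u /nucleus_commutantP[defect1_0 defect2_0].
have [t u2E] : exists t, u.2 = W21 * t by exists (u.2 / W21); field.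
(* The (1, 1) and (2, 1) entries of T W = W T. *)
have y_comm : entry12 u = W12 * t.
  apply: (mulIf W21_neq0); apply/eqP; rewrite -subr_eq0; apply/eqP.
  transitivity (entry12 u * W21 - W12 * u.2); first by rewrite u2E; ring.
  rewrite -defect1_0 /defect1 /entry12 /entry22 /W12 /W21.
  by rewrite !(rmorphD, rmorphN, rmorphM) !sigmaK; ring.
have w_comm : entry22 u = u.1 + (W22 - W11) * t.
  apply: (mulIf W21_neq0); apply/eqP; rewrite -subr_eq0; apply/eqP.
  transitivity (entry22 u * W21 - (u.1 * W21 + (W22 - W11) * u.2)).
    by rewrite u2E; ring.
  rewrite -defect2_0 /defect2 /entry12 /entry22 /W11 /W22 /W21.
  by rewrite !(rmorphD, rmorphN, rmorphM) !sigmaK; ring.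
have su1 : sigma u.1 = entry22 u - mu * sigma u.2 + nu * u.2.
  by rewrite /entry22; ring.
have st : sigma t = t.
  apply: (mulfI form_det_neq0).
  apply: (mulfI (x := sigma W21)); first by rewrite fmorph_eq0.
  have := y_comm; rewrite /entry12 su1 w_comm u2E => /eqP.
  rewrite -subr_eq0 => /eqP y0.
  apply/eqP; rewrite -subr_eq0 -y0; apply/eqP.
  rewrite /form_det /W11 /W12 /W22 /W21.
  by rewrite !(rmorphD, rmorphN, rmorphM) !sigmaK; ring.
exists (u.1 - t * W11), t; split.
- apply/fixed1P; rewrite rmorphB su1 w_comm u2E.
  by rewrite /W22 /W11 /W21 !(rmorphD, rmorphN, rmorphM) st !sigmaK; ring.
- exact/fixed1P.
- by rewrite subrK mulrC -u2E -surjective_pairing.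
Qed.

End TwistedFamily.

Arguments sform {L}.
Arguments flip {L}.

(** * Powers of the Frobenius map *)

Lemma exists_frobenius {L : finFieldType} {p : nat} (s : nat) :
  p \in [pchar L] ->
  exists sigma : {rmorphism L -> L}, forall x, sigma x = x ^+ (p ^ s).
Proof.
move=> charLp; elim: s => [|s [sigma sigmaE]]; first by exists idfun.
exists (pFrobenius_aut charLp \o sigma) => x /=.
by rewrite pFrobenius_autE sigmaE -exprM expnSr.
Qed.

Lemma exists_exp_neq {L : finFieldType} {q : nat} :
  (1 < q < #|L|)%N -> exists a : L, a ^+ q != a.
Proof.
case/andP=> q_gt1 q_lt; apply/existsP; apply: contraTT q_lt => /existsPn fixL.
have szP : size ('X^q - 'X : {poly L}) = q.+1.
  by rewrite size_polyDl size_polyXn // size_polyN size_polyX.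
have P0 : 'X^q - 'X != 0 :> {poly L} by rewrite -size_poly_eq0 szP.
rewrite -leqNgt -ltnS -szP cardE; apply: max_poly_roots => //.
  apply/allP => x _; rewrite rootE !hornerE subr_eq0.
  by have := fixL x; rewrite negbK.
exact: enum_uniq.
Qed.

Section PowerMap.

Variables (L : finFieldType) (sigma : {rmorphism L -> L}) (q : nat).
Hypothesis sigmaE : forall x, sigma x = x ^+ q.

Lemma fixed_field_fixed1 : fixed_field L q = fixed1 sigma.
Proof. by apply/setP => x; rewrite !inE sigmaE. Qed.

Lemma fixed_field_fixed2 : fixed_field L (q ^ 2) = fixed2 sigma.
Proof. by apply/setP => x; rewrite !inE !sigmaE -exprM. Qed.

Lemma kpowers_free l : (0 < q)%N -> - l \notin kpowers L q.-1 ->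
  forall t, t + l * sigma t = 0 -> t = 0.
Proof.
move=> q_gt0 ln t tl; apply/eqP; apply: contraNT ln => t0.
have st0 : sigma t != 0 by rewrite fmorph_eq0.
apply/imsetP; exists t^-1 => //; apply: (mulIf st0).
rewrite mulNr; apply/eqP; rewrite eq_sym -subr_eq0 opprK; apply/eqP.
rewrite -[RHS]tl sigmaE -(prednK q_gt0) exprS exprVn /=.
by field; rewrite expf_neq0.
Qed.

(** The norm factor [c * sigma c] leaves the class of [E] unchanged; it is there
because for N = n ^ (sigma - 1) the determinant of the form of B is
[1 - 1 / n] times the norm of [n]. *)
Lemma norm_classP E c : E != 0 -> c != 0 ->
  reflect (exists2 z, z != 0 &
             sigma (E * (c * sigma c) * sigma z) = E * (c * sigma c) * z)
          (E \in nz_mul_kpowers (fixed_field L q) q.+1).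
Proof.
rewrite fixed_field_fixed1 => E0 c0.
have sc0 : sigma c != 0 by rewrite fmorph_eq0.
apply: (iffP imset2P) => [[k b /setD1P[k0 /fixed1P kK] /imsetP[a]]|[z z0 zz]].
  rewrite in_setC1 => a0 -> ->; exists (c * a)^-1.
    by rewrite invr_eq0 mulf_neq0.
  rewrite exprS -sigmaE !(fmorphV, rmorphM) kK.
  by field; rewrite !fmorph_eq0 a0 c0.
have sz0 : sigma z != 0 by rewrite fmorph_eq0.
exists (E * (c * sigma c) * (z * sigma z)) ((c * z)^-1 ^+ q.+1).
- apply/setD1P; split; first by rewrite !mulf_neq0.
  apply/fixed1P.
  transitivity (sigma (E * (c * sigma c) * sigma z) * sigma z); first by ring.
  by rewrite zz; ring.
- by apply: imset_f; rewrite in_setC1 invr_eq0 mulf_neq0.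
- by rewrite exprS -sigmaE fmorphV rmorphM; field; rewrite c0 z0 sc0 sz0.
Qed.

Variables (l mu nu rho : L) (mul : L * L -> L * L -> L * L).
Hypothesis mulE : forall X Y, mul X Y =
  (sform sigma mu nu rho X Y + l * sform sigma mu nu rho (flip Y) (flip X),
   X.1 * Y.2 + X.2 * Y.1).
Hypothesis l_free : forall t, t + l * sigma t = 0 -> t = 0.
Hypothesis sform_aniso :
  forall Y, sform sigma mu nu rho (flip Y) Y = 0 -> Y = 0.
Hypothesis sigma_neq_id : exists a, sigma a != a.

Lemma sheared_middle_nucleus E c :
  (2%:R : L) != 0 -> mu = - sigma nu -> c != 0 ->
  rho - nu * mu = E * (c * sigma c) ->
  let smul := semifield_mul mul in
  let Nm := middle_nucleus smul in
  let K2 := fixed_field L (q ^ 2) in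
  (E \notin nz_mul_kpowers (fixed_field L q) q.+1 ->
     equals_subfield smul Nm K2) /\
  (E \in nz_mul_kpowers (fixed_field L q) q.+1 ->
     quadratic_extension smul Nm K2).
Proof.
move=> two0 muE c0 DE smul Nm K2.
have E0 : E != 0.
  have := form_det_neq0 L sigma mu nu rho sform_aniso; rewrite /form_det DE.
  by apply: contra => /eqP->; rewrite mul0r.
rewrite /K2 fixed_field_fixed2; split=> [/(norm_classP _ _ E0 c0) noz|].
  apply: (sheared_nucleus_K2 _ _ l mu nu rho) => // z.
  rewrite /form_det DE => zz; apply/eqP; apply/negPn/negP => z0; apply: noz.
  by exists z.
case/(norm_classP _ _ E0 c0) => z z0; rewrite -DE => zz.
exact: (sheared_nucleus_quadratic _ _ l mu nu rho _ _ _ _ _ z).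
Qed.

End PowerMap.

(** * The presemifields B and C *)

Lemma C_form_aniso (L : finFieldType) (sigma : {rmorphism L -> L}) q R :
  (forall x, sigma x = x ^+ q) -> R \notin kpowers L q.+1 ->
  forall Y, sform sigma 0 0 R (flip Y) Y = 0 -> Y = 0.
Proof.
move=> sigmaE Rn [c d]; rewrite /sform /flip /= => cd.
have {}cd : c * sigma c = R * (d * sigma d).
  by apply/eqP; rewrite -subr_eq0 -cd; apply/eqP; ring.
have [d0|d0] := eqVneq d 0.
  by move/eqP: cd; rewrite d0 mul0r mulr0 mulf_eq0 fmorph_eq0 orbb => /eqP->.
case/negP: Rn; apply/imsetP; exists (c / d) => //.
rewrite exprS -sigmaE fmorph_div.
have sd0 : sigma d != 0 by rewrite fmorph_eq0.
transitivity ((c * sigma c) / (d * sigma d)); last by field; rewrite d0 sd0.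
by rewrite cd; field; rewrite d0 sd0.
Qed.

(** The substitution d / c = - (x + 1) turns the form, divided by
n N c c^sigma, into the polynomial of the hypothesis. *)
Lemma B_form_aniso (L : finFieldType) (sigma : {rmorphism L -> L}) q n N :
  (forall x, sigma x = x ^+ q) -> n != 0 -> N != 0 ->
  (forall x, x ^+ q.+1 + (1 - 1 / N) * x + (1 / n - 1) / N != 0) ->
  forall Y, sform sigma (n * N) (- n) (- (n * N)) (flip Y) Y = 0 -> Y = 0.
Proof.
move=> sigmaE n0 N0 noroot [c d]; rewrite /sform /flip /= => cd.
have [c0|c0] := eqVneq c 0.
  move/eqP: cd; rewrite c0 rmorph0 mul0r add0r mulr0 add0r.
  rewrite mulNr mulNr mulrN opprK.
  by rewrite !mulf_eq0 fmorph_eq0 (negPf n0) (negPf N0) /= orbb => /eqP->.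
have sc0 : sigma c != 0 by rewrite fmorph_eq0.
case/negP: (noroot (- (d / c) - 1)); apply/eqP.
rewrite exprS -sigmaE rmorphB rmorphN fmorph_div rmorph1.
rewrite -[RHS](mul0r (n * N * (c * sigma c))^-1) -cd.
by field; rewrite n0 N0 c0 sc0.
Qed.

Theorem theorem8p23 (p m s : nat) (L : finFieldType)
  (p_prime : prime p) (p_odd : odd p)
  (card_L : #|L| = (p ^ m)%N)
  (s_gt0 : (0 < s)%N) (s_lt_m : (s < m)%N) :
  let sg := (p ^ s)%N in
  let K1 := fixed_field L sg in
  let K2 := fixed_field L (sg ^ 2) in
  [/\ (forall l R : L, C_params sg l R ->
        let mul := semifield_mul (C_mul sg l R) in
        let Nm := middle_nucleus mul in
        (R \notin nz_mul_kpowers K1 sg.+1 -> equals_subfield mul Nm K2) /\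
        (R \in nz_mul_kpowers K1 sg.+1 -> quadratic_extension mul Nm K2)),
      (forall l n : L, B_params sg l n (n ^+ sg.-1) ->
        let mul := semifield_mul (B_mul sg l n (n ^+ sg.-1)) in
        let Nm := middle_nucleus mul in
        (1 - 1 / n \notin nz_mul_kpowers K1 sg.+1 ->
           equals_subfield mul Nm K2) /\
        (1 - 1 / n \in nz_mul_kpowers K1 sg.+1 ->
           quadratic_extension mul Nm K2)),
      (forall l n N : L, B_params sg l n N -> N != n ^+ sg.-1 ->
        let mul := semifield_mul (B_mul sg l n N) in
        let Nm := middle_nucleus mul in
        Nm :&: [set emb x | x : L] = [set emb x | x in K1])
    & (forall k : nat, m = (2 * k)%N -> s = k ->
       forall l n N : L, B_params sg l n N -> N != n ^+ sg.-1 ->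
        let mul := semifield_mul (B_mul sg l n N) in
        let Nm := middle_nucleus mul in
        quadratic_extension mul Nm K1)].
Proof.
move=> sg K1 K2.
have charLp : p \in [pchar L] by apply: card_finPcharP card_L p_prime.
have two0 : (2%:R : L) != 0.
  rewrite -(dvdn_pcharf charLp) dvdn_prime2 //.
  by apply/negP => /eqP pE; move: p_odd; rewrite pE.
have sg_gt0 : (0 < sg)%N by rewrite expn_gt0 prime_gt0.
have [sigma sigmaE] := exists_frobenius s charLp; rewrite -/sg in sigmaE.
have sigma_neq_id : exists a, sigma a != a.
  have [|a aE] := exists_exp_neq (L := L) (q := sg); last first.
    by exists a; rewrite sigmaE.
  have p_gt1 := prime_gt1 p_prime.
  by rewrite card_L /sg -{1}(expn0 p) !ltn_exp2l // s_gt0.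
have B_mulE l n N X Y : B_mul sg l n N X Y =
    (sform sigma (n * N) (- n) (- (n * N)) X Y +
     l * sform sigma (n * N) (- n) (- (n * N)) (flip Y) (flip X),
     X.1 * Y.2 + X.2 * Y.1).
  case: X Y => [a b] [c d]; rewrite /B_mul -!sigmaE /sform /flip /=.
  by congr pair; ring.
have C_mulE l R X Y : C_mul sg l R X Y =
    (sform sigma 0 0 R X Y + l * sform sigma 0 0 R (flip Y) (flip X),
     X.1 * Y.2 + X.2 * Y.1).
  case: X Y => [a b] [c d]; rewrite /C_mul -!sigmaE /sform /flip /=.
  by congr pair; ring.
have mulXpred n : n * n ^+ sg.-1 = sigma n.
  by rewrite -exprS prednK // sigmaE.
have B_sigma n N : n != 0 -> N != n ^+ sg.-1 -> n * N != - sigma (- n).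
  move=> n0; apply: contra.
  by rewrite rmorphN opprK -mulXpred => /eqP/(mulfI n0)->.
split.
- move=> l R [/andP[_ R0] l_pow R_pow].
  apply: (sheared_middle_nucleus _ _ _ sigmaE l 0 0 R _ (C_mulE l R)
            _ _ _ R 1) => //.
  + exact: kpowers_free sigmaE _ sg_gt0 l_pow.
  + exact: C_form_aniso sigmaE R_pow.
  + by rewrite rmorph0 oppr0.
  + exact: oner_neq0.
  + by rewrite rmorph1; ring.
- move=> l n [/and3P[_ n0 N0] l_pow noroot].
  apply: (sheared_middle_nucleus _ _ _ sigmaE l _ _ _ _ (B_mulE l n _)
            _ _ _ _ n) => //.
  + exact: kpowers_free sigmaE _ sg_gt0 l_pow.
  + exact: B_form_aniso sigmaE n0 N0 noroot.
  + by rewrite mulXpred rmorphN opprK.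
  + by rewrite mulXpred; field.
- move=> l n N [/and3P[_ n0 N0] l_pow noroot] NE mul Nm.
  rewrite /K1 (fixed_field_fixed1 _ _ _ sigmaE).
  apply: (unsheared_nucleus_cap _ _ _ _ _ _ _ (B_mulE l n N)) => //.
  + exact: kpowers_free sigmaE _ sg_gt0 l_pow.
  + exact: B_form_aniso sigmaE n0 N0 noroot.
  + exact: B_sigma.
- move=> k mE sE l n N [/and3P[_ n0 N0] l_pow noroot] NE mul Nm.
  rewrite /K1 (fixed_field_fixed1 _ _ _ sigmaE).
  apply: (unsheared_nucleus_quadratic _ _ _ _ _ _ _ (B_mulE l n N)) => //.
  + exact: kpowers_free sigmaE _ sg_gt0 l_pow.
  + exact: B_form_aniso sigmaE n0 N0 noroot.
  + exact: B_sigma.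
  + move=> x; rewrite !sigmaE -exprM /sg -expnD sE addnn -mul2n -mE -card_L.
    exact: expf_card.
Qed.
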